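(* Let $\kappa$ be a cardinal and suppose there exists a family $\{N_\zeta:\zeta<\kappa\}$ of $\kappa$ pairwise almost disjoint subsets of $\mathfrak{c}$, each of cardinality $\mathfrak{c}$. Then the set $\mathcal{SZ}(\mathbb R)$ of Sierpi\'nski-Zygmund functions is strongly $\kappa$-algebrable in the algebra $\mathbb R^{\mathbb R}$.
   Context: $\mathfrak{c}$ denotes the cardinality of $\mathbb R$, identified with the first ordinal of that cardinality. Two subsets $A,B$ of $\mathfrak{c}$, each of cardinality $\mathfrak{c}$, are almost disjoint if $|A\cap B|<\mathfrak{c}$. A function $f:\mathbb R\to\mathbb R$ is a Sierpi\'nski-Zygmund function if for every set $Z\subset\mathbb R$ of cardinality $\mathfrak{c}$ the restriction $f|_Z$ is not a Borel map. $\mathbb R^{\mathbb R}$ is the commutative algebra of all functions $\mathbb R\to\mathbb R$ with pointwise operations. A subset $E$ of a commutative algebra $B$ is strongly $\kappa$-algebrable if there exists a $\kappa$-generated free algebra contained in $E\cup\{0\}$; equivalently, there is a set $X=\{x_\alpha:\alpha<\kappa\}\subset B$ (with $x_\alpha$ distinct) such that the set of all monomials $x_{\alpha_1}^{k_1}\cdots x_{\alpha_n}^{k_n}$ ($n\ge1$, distinct $\alpha_i$, $k_i\ge1$) is linearly independent and every nontrivial linear combination of such monomials lies in $E$ (i.e. for every nonzero polynomial $P$ without constant term and distinct $x_{\alpha_1},\dots,x_{\alpha_n}$, $P(x_{\alpha_1},\dots,x_{\alpha_n})$ is nonzero and belongs to $E$). *)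

(* Defs.v *)
(* MathComp-Analysis over Stdlib's concrete reals R
   (a realType via Rstruct), multivariate polynomials from multinomials
   (required without Import to avoid notation clashes with analysis; hence
   "P is a nonzero polynomial" is written as "some coefficient of P is
   nonzero", which is what P != 0 unfolds to). *)
From Stdlib Require Import Reals.
From HB Require Import structures.
From mathcomp Require Import all_boot all_order all_algebra.
From mathcomp Require Import all_classical all_reals all_analysis.
From mathcomp Require Import Rstruct Rstruct_topology.
From mathcomp Require mpoly.

Set Implicit Arguments.
Unset Strict Implicit.
Unset Printing Implicit Defensive.
Import Order.TTheory GRing.Theory Num.Theory.

Local Open Scope classical_set_scope.
Local Open Scope card_scope.
Local Open Scope ring_scope.

Definition Borel (Y : set R) : Prop :=
  smallest (sigma_algebra setT) [set U : set R | open U] Y.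

(* The restriction f|_Z : Z -> R is Borel, where Z carries the subspace
   topology; Borel sets of the subspace Z are the traces Z `&` B of Borel B. *)
Definition restr_borel (Z : set R) (f : R -> R) : Prop :=
  forall Y : set R, Borel Y ->
    exists B : set R, Borel B /\ Z `&` (f @^-1` Y) = Z `&` B.

Definition card_c (A : set R) : Prop := A #= [set: R].
(* |A| < c for A a set of reals (|A| <= c is automatic) *)
Definition card_lt_c (A : set R) : Prop := ~ ([set: R] #<= A).

Definition SZ (f : R -> R) : Prop :=
  forall Z : set R, card_c Z -> ~ restr_borel Z f.

Definition peval (n : nat) (P : mpoly.mpoly n R) (g : 'I_n -> R -> R)
  : R -> R := fun t => mpoly.meval (fun i => g i t) P.

Definition strongly_algebrable (K : Type) (E : (R -> R) -> Prop) : Prop :=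
  exists x : K -> R -> R,
    injective x /\
    forall (n : nat) (a : 'I_n -> K) (P : mpoly.mpoly n R),
      injective a ->
      (exists m, mpoly.mcoeff m P <> 0) -> mpoly.mcoeff (@mpoly.mnm0 n) P = 0 ->
      peval P (fun i => x (a i)) <> (fun _ => 0) /\
      E (peval P (fun i => x (a i))).

(* Main.v *)
Require Import Defs.
From Stdlib Require Import Reals.
From HB Require Import structures.
From mathcomp Require Import all_boot all_order all_algebra.
From mathcomp Require Import all_classical all_reals all_analysis.
From mathcomp Require Import Rstruct Rstruct_topology.
From mathcomp Require mpoly.
From mathcomp Require Import wochoice lra.
(* The notations of [mpoly] clash with those of the analysis library. *)
Import -(notations) mpoly.

Set Implicit Arguments.
Unset Strict Implicit.
Unset Printing Implicit Defensive.

Import Order.TTheory GRing.Theory Num.Theory numFieldNormedType.Exports.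

Local Open Scope classical_set_scope.
Local Open Scope card_scope.

(** Call a set small if it is smaller than the continuum.  A Borel map on a set
    of reals is determined by the traces of the Borel sets on which it lies below
    a rational, and countable sequences of Borel sets are coded by well-founded
    trees, of which there are continuum many.  Hence there are functions [G c],
    indexed by reals [c], that extend all these maps, and a function that agrees
    with each [G c] only on a small set is Sierpinski-Zygmund.

    The segments of a suitable order yield small sets [S t] such that each real
    lies in [S t] for all [t] outside a small set.  Let [F t] consist of [S t] and
    of the values [- G c t] with [c] in [S t].  As an infinite set [A] is
    equipotent with the set of elements algebraic over [A], a maximal set of reals
    algebraically independent over [F t] has continuum many elements [y t u].
    With injections [nu z : R -> N z], the generators are [y t (nu z t)].
    For a polynomial [P] in finitely many of them, almost disjointness makes the
    indices [nu z t] distinct for all [t] outside a small set, and independence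
    then forbids that [P] takes the value [G c t] as soon as [F t] contains
    [- G c t] and the coefficients of [P]. *)

(** * Cardinal arithmetic *)

Definition card_lt {T U : Type} (A : set T) (B : set U) : Prop := ~ (B #<= A).
Notation "A '#<' B" := (card_lt A B) (at level 79) : card_scope.

Lemma card_le_setTP {T U : Type} {B : set U} :
  [set: T] #<= B <-> exists2 f : T -> U, injective f & forall x, B (f x).
Proof.
split=> [/card_leP[f]|[f finj fB]].
  exists (fun x => val (f (to_setT x))) => [x y|x]; last exact: set_valP.
  by move=> /val_inj/(@inj _ _ _ f); rewrite !inE => /(_ I I)[].
rewrite -(card_le_eql (inj_card_eq (in2W finj))).
by apply: subset_card_le => _ [x _ <-].
Qed.

Lemma card_le_injective_rel {T U : Type} (A : set T) (B : set U)
    (G : T -> U -> Prop) :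
  (forall x, A x -> exists2 y, B y & G x y) ->
  (forall x x' y, G x y -> G x' y -> x = x') -> A #<= B.
Proof.
elim/Ppointed: T => T in A G *; first by rewrite emptyE.
move=> AG Ginj; apply/pcard_surjP.
exists (fun y => xget point [set x | G x y]) => x /AG[y By Gxy].
exists y => //=; apply: (Ginj _ _ y) => //.
exact: (@xgetI _ _ [set z | G z y] x).
Qed.

Lemma card_le_total {T U : Type} (A : set T) (B : set U) :
  A #<= B \/ B #<= A.
Proof.
pose matching (G : set (T * U)) := [/\ G `<=` A `*` B,
  forall x x' y, G (x, y) -> G (x', y) -> x = x' &
  forall x y y', G (x, y) -> G (x, y') -> y = y'].
have [F FP Ftot|G [[GAB Gl Gr] Gmax]] := @Zorn_bigcup _ matching.
  have chain p q : (\bigcup_(X in F) X) p -> (\bigcup_(X in F) X) q ->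
      exists X, [/\ F X, X p & X q].
    move=> [X FX Xp] [Y FY Yq].
    by have [XY|YX] := Ftot _ _ FX FY; [exists Y|exists X]; split;
      rewrite //; [exact: XY|exact: YX].
  split=> [p [X /FP[+ _ _]]|x x' y xy x'y|x y y' xy xy']; first exact.
  - by have [X [/FP[_ Xl _] Xxy Xx'y]] := chain _ _ xy x'y; exact: Xl Xxy Xx'y.
  - by have [X [/FP[_ _ Xr] Xxy Xxy']] := chain _ _ xy xy'; exact: Xr Xxy Xxy'.
have [domG|/existsNP[a /not_implyP[Aa /forallNP Ga]]] :=
    pselect (forall x, A x -> exists y, G (x, y)).
  left; apply: (card_le_injective_rel (G := fun x y => G (x, y))) => //.
  by move=> x /domG[y Gxy]; exists y => //; have [] := GAB _ Gxy.
right; apply: (card_le_injective_rel (G := fun y x => G (x, y))) => [b Bb|y y' x];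
  last exact: Gr.
apply: contrapT => /forall2NP Gb; apply: (Gmax (G `|` [set (a, b)])).
  split=> [p|/(_ (a, b))]; first by left.
  by move=> /(_ (or_intror erefl)); exact: Ga.
have {}Gb x : ~ G (x, b) by move=> Gxb; case: (Gb x) => //; have [] := GAB _ Gxb.
split=> [p [/GAB//|->//]|x x' y|x y y'].
- move=> [Gxy|[? yb]] [Gx'y|[? yb']]; subst=> //; first exact: Gl Gxy Gx'y.
  + by case: (Gb x).
  + by case: (Gb x').
- move=> [Gxy|[xa ?]] [Gxy'|[xa' ?]]; subst=> //; first exact: Gr Gxy Gxy'.
  + by case: (Ga y).
  + by case: (Ga y').
Qed.

Lemma countable_card_le {T U : Type} (A : set T) (C : set U) :
  countable A -> infinite_set C -> A #<= C.
Proof. by move=> cA /infiniteP; exact: card_le_trans. Qed.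

Lemma uncountable_infinite {T : Type} (A : set T) :
  ~ countable A -> infinite_set A.
Proof. by apply: contra_not; exact: finite_set_countable. Qed.

Lemma card_leX {T T' U U' : Type} (A : set T) (B : set U) (A' : set T')
    (B' : set U') :
  A #<= A' -> B #<= B' -> A `*` B #<= A' `*` B'.
Proof.
elim/Ppointed: T => T in A *; first by rewrite (empty_eq0 A) set0X.
elim/Ppointed: U => U in B *; first by rewrite (empty_eq0 B) setX0.
move=> /pcard_surjP[f fA] /pcard_surjP[g gB]; apply/pcard_surjP.
exists (fun p => (f p.1, g p.2)) => -[x y] [/= /fA[x' Ax' <-] /gB[y' By' <-]].
by exists (x', y').
Qed.

(* With [infinite_card_leX] below, the assumption on squares reduces to
   [infinite_set C], but the proof of that lemma relies on the present form. *)
Lemma card_le_bigcup {I T U : Type} (D : set I) (F : I -> set T) (C : set U) :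
  C `*` C #<= C -> D #<= C -> (forall i, D i -> F i #<= C) ->
  \bigcup_(i in D) F i #<= C.
Proof.
elim/Ppointed: I => I in D F *; first by rewrite (empty_eq0 D) bigcup_set0.
elim/Ppointed: T => T in F *; first by rewrite emptyE.
move=> CC /pcard_surjP[g gD] FC; apply: card_le_trans CC.
have /choice[h hF] i : exists h : U -> T, D i -> set_surj C (F i) h.
  have [/FC/pcard_surjP[h hF]|nDi] := pselect (D i); first by exists h.
  by exists (fun=> point).
apply/pcard_surjP; exists (fun p => h (g p.1) p.2) => x [i Di Fix].
have [c Cc gc] := gD i Di; have [c' Cc' hc'] := hF i Di x Fix.
by exists (c, c'); rewrite //= gc.
Qed.

Lemma card_leU {T U : Type} (A B : set T) (C : set U) : infinite_set C ->
  C `*` C #<= C -> A #<= C -> B #<= C -> A `|` B #<= C.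
Proof.
move=> Cinf CC AC BC; rewrite -bigcup2E; apply: card_le_bigcup => //.
  exact/infiniteP.
by move=> [|[|n]].
Qed.

Section Pairings.
Variable T : pointedType.
Implicit Types (B : set T) (f : T * T -> T).

Definition pairing_on B f :=
  set_fun (B `*` B) B f /\
  forall z z', (B `*` B) z -> (B `*` B) z' -> f z = f z' -> z = z'.

Definition pairing_extends (p q : set T * (T * T -> T)) :=
  p.1 `<=` q.1 /\ forall z, (p.1 `*` p.1) z -> p.2 z = q.2 z.

Lemma pairing_extends_refl (p : set T * (T * T -> T)) :
  pairing_extends p p.
Proof. by split=> // x. Qed.

Lemma pairing_extends_trans (p q r : set T * (T * T -> T)) :
  pairing_extends p q -> pairing_extends q r -> pairing_extends p r.
Proof.
move=> [pq epq] [qr eqr]; split=> [|z [pz1 pz2]]; first exact: subset_trans qr.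
by rewrite epq ?eqr //; split; exact: pq.
Qed.

Lemma pairing_onP B : (exists f, pairing_on B f) <-> B `*` B #<= B.
Proof.
split=> [[f [fB finj]]|/pcard_leP].
  apply/pcard_leP; rewrite injfunPex; exists f => // p q.
  by rewrite !inE; exact: finj.
rewrite injfunPex => -[f fB finj]; exists f; split=> // p q Bp Bq.
by apply: finj; rewrite inE.
Qed.

Lemma pairing_chain_ub (F : set (set T * (T * T -> T))) :
  F `<=` (fun p => pairing_on p.1 p.2) -> total_on F pairing_extends ->
  exists f, pairing_on (\bigcup_(p in F) p.1) f /\
    forall p, F p -> pairing_extends p (\bigcup_(p in F) p.1, f).
Proof.
move=> FP Ftot.
have chain p q : F p -> F q ->
    exists r, [/\ F r, pairing_extends p r & pairing_extends q r].
  by move=> Fp Fq; have [pq|qp] := Ftot p q Fp Fq; [exists q|exists p]; split=> //;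
    exact: pairing_extends_refl.
have /choice[f fE] z : exists w, forall p, F p -> (p.1 `*` p.1) z -> p.2 z = w.
  have [[p [Fp pz]]|nz] := pselect (exists p, F p /\ (p.1 `*` p.1) z).
    exists (p.2 z) => q Fq qz; have [r [_ [_ pr] [_ qr]]] := chain p q Fp Fq.
    by rewrite pr // qr.
  by exists z.1 => p Fp pz; case: nz; exists p.
have square z : ((\bigcup_(p in F) p.1) `*` (\bigcup_(p in F) p.1)) z ->
    exists2 p, F p & (p.1 `*` p.1) z.
  move=> [[p Fp pz] [q Fq qz]]; have [r [Fr [pr _] [qr _]]] := chain p q Fp Fq.
  by exists r => //; split; [exact: pr|exact: qr].
exists f; split; last by move=> p Fp; split=> [x px|z pz]; [exists p|exact: fE].
split=> [z /square[p Fp pz]|z z' /square[p Fp pz] /square[q Fq qz']].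
  by exists p => //; rewrite -(fE _ p) //; have [fun_p _] := FP _ Fp; exact: fun_p.
have [r [Fr [pr _] [qr _]]] := chain p q Fp Fq; have [_ inj_r] := FP _ Fr.
have rz : (r.1 `*` r.1) z by case: pz => *; split; exact: pr.
have rz' : (r.1 `*` r.1) z' by case: qz' => *; split; exact: qr.
by rewrite -(fE _ r) // -(fE z' r) //; exact: inj_r.
Qed.

(* The pairs that are not in [B * B] are first injected into [B], which has the
   cardinality of [B `|` g @` B], and then sent into [g @` B]. *)
Lemma pairing_extend B f (g : T -> T) :
  infinite_set B -> pairing_on B f ->
  (forall x, B x -> ~ B (g x)) -> {in B &, injective g} ->
  exists f', pairing_on (B `|` g @` B) f' /\
    pairing_extends (B, f) (B `|` g @` B, f').
Proof.
move=> Binf fP gB ginj; have [f_fun f_inj] := fP; pose C := B `|` g @` B.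
have : C #<= B.
  by apply: card_leU; rewrite ?card_image_le //; by apply/pairing_onP; exists f.
move=> /pcard_leP; rewrite injfunPex => -[e eB einj].
have fB x y : C x -> C y -> B (f (e x, e y)).
  by move=> Cx Cy; apply: f_fun; split; exact: eB.
exists (fun z => if `[< (B `*` B) z >] then f z else g (f (e z.1, e z.2))).
split; last by split=> [x|z Bz]; [left|rewrite /= asboolT].
split=> [z [Cz1 Cz2]|z z' [Cz1 Cz2] [Cz1' Cz2']].
  case: asboolP => [Bz|_]; first by left; exact: f_fun.
  by right; exists (f (e z.1, e z.2)) => //; exact: fB.
case: asboolP => [Bz|_]; case: asboolP => [Bz'|_]; first exact: f_inj.
- move=> ff; case: (gB (f (e z'.1, e z'.2))); rewrite -?ff;
    by [exact: fB|exact: f_fun].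
- move=> ff; case: (gB (f (e z.1, e z.2))); rewrite ?ff;
    by [exact: fB|exact: f_fun].
- move=> /ginj; rewrite !inE => /(_ (fB _ _ Cz1 Cz2) (fB _ _ Cz1' Cz2')) ez.
  have [/einj ez1 /einj ez2] : (e z.1, e z.2) = (e z'.1, e z'.2).
    by apply: f_inj ez; split; exact: eB.
  by rewrite [z]surjective_pairing [z']surjective_pairing ez1 ?inE // ez2 ?inE.
Qed.

Lemma maximal_pairing : infinite_set [set: T] ->
  exists B (f : T * T -> T), [/\ infinite_set B, pairing_on B f &
    forall C h, pairing_on C h -> pairing_extends (B, f) (C, h) -> C `<=` B].
Proof.
move=> /infiniteP/card_le_setTP[e einj _].
pose P (p : set T * (T * T -> T)) := range e `<=` p.1 /\ pairing_on p.1 p.2.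
have /infiniteP einf : [set: nat] #<= range e.
  by apply/card_le_setTP; exists e.
have [f0 f0P] : exists f, pairing_on (range e) f.
  apply/pairing_onP; apply: countable_card_le => //.
  by apply: countableX; exact: card_image_le.
pose ext (p q : {p | P p}) := `[< pairing_extends (sval p) (sval q) >].
have Pe : P (range e, f0) by split.
have [|p q r|F Ftot|] := ZL_preorder (exist P _ Pe) (R := ext).
- by move=> p; apply/asboolP; exact: pairing_extends_refl.
- by move=> /asboolP pq /asboolP qr; apply/asboolP; exact: pairing_extends_trans qr.
- have [[p0 Fp0]|F0] := pselect (exists p, F p); last first.
    by exists (exist P _ Pe) => p Fp; case: F0; exists p.
  have [||f [fP fub]] := pairing_chain_ub (F := sval @` F).
  + by move=> _ [p _ <-]; have [] := svalP p.
  + move=> _ _ [p Fp <-] [q Fq <-].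
    by have [/asboolP|/asboolP] := Ftot _ _ Fp Fq; [left|right].
  have Pf : P (\bigcup_(p in sval @` F) p.1, f).
    split=> // x ex; exists (sval p0); first exact: imageP.
    by have [+ _] := svalP p0; apply.
  exists (exist P _ Pf) => p Fp; apply/asboolP; apply: fub; exact: imageP.
- move=> [[B f] [eB fP]] fmax; exists B, f; split=> //.
    exact: (sub_infinite_set eB).
  move=> C h hP Bh.
  have PC : P (C, h) by split=> //; apply: subset_trans Bh.1.
  have /asboolP[] : ext (exist P _ PC) (exist P _ (conj eB fP)) => //.
  by apply: fmax; apply/asboolP.
Qed.

Lemma infinite_card_leX_setT :
  infinite_set [set: T] -> [set: T] `*` [set: T] #<= [set: T].
Proof.
move=> /maximal_pairing[B [f [Binf fP Bmax]]].
have BB : B `*` B #<= B by apply/pairing_onP; exists f.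
have [/pcard_leP|nBB] := card_le_total B (~` B).
  rewrite injfunPex => -[g gB ginj].
  have [h [hP Bh]] := pairing_extend Binf fP gB ginj.
  have [b Bb] := infinite_setN0 Binf.
  by case: (gB b Bb); apply: (Bmax _ _ hP Bh); right; exists b.
have TB : [set: T] #<= B by rewrite -(setUv B); exact: card_leU.
apply: card_le_trans (card_leT B); apply: card_le_trans BB.
exact: card_leX.
Qed.

End Pairings.

Lemma infinite_card_leX {T : Type} (A : set T) :
  infinite_set A -> A `*` A #<= A.
Proof.
move=> Ainf; have /card_eqPle[AT TA] := card_setT A.
apply: card_le_trans (card_leX TA TA) (card_le_trans _ AT).
have : infinite_set [set: A] by apply: contra_not Ainf; exact: card_le_finite.
elim/Ppointed: (A : Type) => T'; last exact: infinite_card_leX_setT.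
by rewrite emptyE => /(_ (finite_set0 _)).
Qed.

Lemma infinite_card_le_bigcup {I T U : Type} (D : set I) (F : I -> set T)
    (C : set U) :
  infinite_set C -> D #<= C -> (forall i, D i -> F i #<= C) ->
  \bigcup_(i in D) F i #<= C.
Proof. by move=> Cinf; apply: card_le_bigcup; exact: infinite_card_leX. Qed.

Definition seq_over {T : eqType} (A : set T) : set (seq T) :=
  [set s | {in s, forall x, A x}].

Lemma seq_over_subset {T : eqType} (A B : set T) :
  A `<=` B -> seq_over A `<=` seq_over B.
Proof. by move=> AB s As x /As/AB. Qed.

Lemma card_le_seq_over {T : eqType} {U : Type} (A : set T) (C : set U) :
  infinite_set C -> A #<= C -> seq_over A #<= C.
Proof.
move=> Cinf AC; pose F n := [set s | seq_over A s /\ size s = n].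
suff FC n : F n #<= C.
  have -> : seq_over A = \bigcup_n F n.
    by apply/seteqP; split=> [s As|s [n _ []//]]; exists (size s).
  apply: infinite_card_le_bigcup => //; exact/infiniteP.
elim: n => [|n IH].
  apply: card_le_trans (countable_card_le (countable1 [::]) Cinf).
  by apply: subset_card_le => s [_ /size0nil].
have FSn : F n.+1 `<=` \bigcup_(x in A) cons x @` F n.
  case=> [|x s] [As // [sn]]; exists x; first by apply: (As x); exact: mem_head.
  by exists s => //; split=> // y ys; apply: As; rewrite inE ys orbT.
apply: (card_le_trans (subset_card_le FSn)).
apply: infinite_card_le_bigcup => // x _; exact: card_le_trans (card_image_le _ _) IH.
Qed.

Lemma finite_card_lt {T U : Type} (A : set T) (C : set U) :
  finite_set A -> infinite_set C -> A #< C.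
Proof. by move=> Afin; apply: contra_not => /card_le_finite; apply. Qed.

Lemma card_le_lt_trans {T U V : Type} (A : set T) (B : set U) (C : set V) :
  A #<= B -> B #< C -> A #< C.
Proof. by move=> AB; apply: contra_not => /card_le_trans; apply. Qed.

Lemma card_lt_subset {T U : Type} (A B : set T) (C : set U) :
  A `<=` B -> B #< C -> A #< C.
Proof. by move=> /subset_card_le; exact: card_le_lt_trans. Qed.

Lemma card_ltU {T U : Type} (A B : set T) (C : set U) :
  infinite_set C -> A #< C -> B #< C -> A `|` B #< C.
Proof.
move=> Cinf; wlog AB : A B / A #<= B => [wlogAB|_ BC].
  have [/wlogAB//|/wlogAB BA] := card_le_total A B.
  by rewrite setUC => *; exact: BA.
have [Bfin|Binf] := pselect (finite_set B).
  apply: finite_card_lt => //; rewrite finite_setU.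
  by split=> //; exact: card_le_finite AB Bfin.
apply: card_le_lt_trans BC; apply: card_leU => //; exact: infinite_card_leX.
Qed.

Lemma card_lt_bigcup_finite {I : choiceType} {T U : Type} (D : set I)
    (F : I -> set T) (C : set U) :
  infinite_set C -> finite_set D -> (forall i, D i -> F i #< C) ->
  \bigcup_(i in D) F i #< C.
Proof.
move=> Cinf /finite_fsetP[X ->] FC; rewrite bigcup_fset big_seq.
apply: (big_ind (fun A => A #< C)) => [||i iX]; last exact: FC.
- exact: finite_card_lt.
- by move=> A B; exact: card_ltU.
Qed.

(* Take an order all of whose segments are small, or else transport a well-order
   along an injection into its first segment that is not small. *)
Lemma total_order_small_segments (T : pointedType) : infinite_set [set: T] ->
  exists2 r : rel T, total r & forall x, [set y | r y x] #< [set: T].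
Proof.
move=> Tinf; have [r wo] := well_ordering_principle T.
have rtot : total r.
  by move=> x y; apply: (@wo_chainW _ r predT) => // A _; exact: wo.
have [|/existsNP[x0 nx0]] := pselect (forall x, [set y | r y x] #< [set: T]).
  by exists r.
have [|x [[nx xmin] _]] := wo [pred x | [set: T] #<= [set y | r y x]].
  by exists x0; exact: (contrapT nx0).
have below_x y : r y x -> y <> x -> [set z | r z y] #< [set: T].
  move=> ryx yx ny; apply: yx.
  apply: (@wo_chain_antisymmetric _ r predT) => //; last by rewrite ryx xmin.
  by move=> A _; exact: wo.
have /card_le_setTP[f finj fx] : [set: T] #<= [set y | r y x] `\ x.
  apply: contrapT => small; have : [set y | r y x] `\ x `|` [set x] #< [set: T].
    by apply: (card_ltU Tinf small); exact: finite_card_lt.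
  by apply; apply: card_le_trans nx _; apply: subset_card_le => y ryx;
    have [->|] := pselect (y = x); [right|left].
exists (fun y z => r (f y) (f z)) => [y z|y]; first exact: rtot.
have [/= rfyx fyx] := fx y; apply: card_le_lt_trans (below_x _ rfyx fyx).
rewrite -(card_le_eql (inj_card_eq (in2W finj))).
by apply: subset_card_le => _ [z rz <-].
Qed.

Lemma small_sets_almost_containing (T : pointedType) : infinite_set [set: T] ->
  exists S : T -> set T, (forall t, S t #< [set: T]) /\
    forall x, [set t | ~ S t x] #< [set: T].
Proof.
move=> /total_order_small_segments[r rtot seg].
exists (fun t => [set x | r x t]); split=> // x.
apply: card_lt_subset (seg x) => t /= nrxt.
by have /orP[] := rtot x t.
Qed.

(** * The cardinality of the continuum *)

Section TernaryExpansions.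
Local Open Scope ring_scope.
Variable F : realType.
Implicit Types b c : nat -> bool.

Definition ternary_sum b (n : nat) : F := \sum_(k < n) (b k)%:R / 3 ^+ k.

Definition ternary_value b : F := sup (range (ternary_sum b)).

Lemma ternary_sumS b n :
  ternary_sum b n.+1 = ternary_sum b n + (b n)%:R / 3 ^+ n.
Proof. by rewrite /ternary_sum big_ord_recr. Qed.

Lemma ternary_sum_le b m n :
  ternary_sum b m <= ternary_sum b n + 3 / 2 / 3 ^+ n.
Proof.
have inv3_gt0 k : 0 < (3 ^+ k : F)^-1 by rewrite invr_gt0 exprn_gt0.
have digit k : 0 <= ((b k)%:R : F) <= 1 by case: (b k); rewrite /= ?lexx ler01.
have lower : nondecreasing_seq (ternary_sum b).
  apply/nondecreasing_seqP => k; rewrite ternary_sumS lerDl.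
  by rewrite divr_ge0 ?ler0n ?exprn_ge0.
have upper : nonincreasing_seq (fun k => ternary_sum b k + 3 / 2 / 3 ^+ k).
  apply/nonincreasing_seqP => k; rewrite ternary_sumS exprS invfM.
  have := inv3_gt0 k; have := digit k.
  by move: (3 ^+ k)^-1 => u /andP[b0 b1] u0; nra.
apply: (le_trans (lower _ _ (leq_maxl m n))).
apply: le_trans (upper _ _ (leq_maxr m n)).
by rewrite lerDl; have := inv3_gt0 (maxn m n); lra.
Qed.

Lemma ternary_value_bounds b n :
  ternary_sum b n <= ternary_value b <= ternary_sum b n + 3 / 2 / 3 ^+ n.
Proof.
apply/andP; split.
  apply: ub_le_sup; last by exists n.
  exists (ternary_sum b 0 + 3 / 2 / 3 ^+ 0) => _ [m _ <-].
  exact: ternary_sum_le.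
apply: ge_sup; first by exists (ternary_sum b 0), 0%N.
by move=> _ [m _ <-]; exact: ternary_sum_le.
Qed.

(* After the first differing digit [n], the sums differ by [1 / 3 ^+ n], and
   the tails contribute at most half of that. *)
Lemma ternary_value_lt b c n : (forall k, (k < n)%N -> b k = c k) ->
  b n = false -> c n -> ternary_value b < ternary_value c.
Proof.
move=> ebc bn cn.
have /andP[_ ub_b] := ternary_value_bounds b n.+1.
have /andP[lb_c _] := ternary_value_bounds c n.+1.
have es : ternary_sum b n = ternary_sum c n by apply: eq_bigr => i _; rewrite ebc.
have inv3_gt0 : 0 < (3 ^+ n : F)^-1 by rewrite invr_gt0 exprn_gt0.
move: ub_b lb_c inv3_gt0; rewrite !ternary_sumS es bn cn /= exprS invfM.
by move: (3 ^+ n)^-1 => u; lra.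
Qed.

Lemma ternary_value_inj : injective ternary_value.
Proof.
move=> b c ebc; apply: contrapT => ne.
have /ex_minnP[n bcn nmin] : exists n, b n != c n.
  apply: contrapT => /forallNP e; apply: ne; apply/funext => n.
  exact/eqP/negPn/negP/e.
have agree k : (k < n)%N -> b k = c k.
  by move=> kn; apply/eqP; apply: contraTT kn => /nmin; rewrite -leqNgt.
case bn: (b n) bcn; case cn: (c n) => // _.
  have := ternary_value_lt (fun k kn => esym (agree k kn)) cn bn.
  by rewrite ebc ltxx.
by have := ternary_value_lt agree bn cn; rewrite ebc ltxx.
Qed.

End TernaryExpansions.

Lemma card_le_cantor_real {F : realType} : [set: nat -> bool] #<= [set: F].
Proof.
apply/card_le_setTP; exists (@ternary_value F) => //; exact: ternary_value_inj.
Qed.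

Lemma uncountable_real {F : realType} : ~ countable [set: F].
Proof.
by move=> /countable_lebesgue_measure0; rewrite -set_itvNyy lebesgue_measure_itv.
Qed.

(** * Sets generated by a countable family *)

Inductive sigma_code := CodeBase of nat | CodeNor of nat -> sigma_code.

HB.instance Definition _ := gen_eqMixin sigma_code.
HB.instance Definition _ := gen_choiceMixin sigma_code.
HB.instance Definition _ := isPointed.Build sigma_code (CodeBase 0).

Fixpoint sigma_set {T : Type} (U : nat -> set T) (c : sigma_code) : set T :=
  match c with
  | CodeBase n => U n
  | CodeNor f => ~` \bigcup_n sigma_set U (f n)
  end.

(* The labelled tree of a code, as a function of the branch. *)
Fixpoint sigma_code_label (c : sigma_code) (s : seq nat) : nat :=
  match c, s with
  | CodeBase n, _ => n.+1
  | CodeNor _, [::] => 0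
  | CodeNor f, n :: s => sigma_code_label (f n) s
  end.

Lemma sigma_code_label_inj : injective sigma_code_label.
Proof.
elim=> [m|f IH] [n|g] e.
- by case: (congr1 (@^~ [::]) e) => ->.
- by have := congr1 (@^~ [::]) e.
- by have := congr1 (@^~ [::]) e.
- congr CodeNor; apply/funext => n; apply: IH; apply/funext => s.
  exact: (congr1 (@^~ (n :: s)) e).
Qed.

Lemma card_le_sigma_code {F : realType} : [set: sigma_code] #<= [set: F].
Proof.
apply: card_le_trans card_le_cantor_real.
pose graph c k :=
  if unpickle k is Some (s, n) then sigma_code_label c s == n else false.
apply/card_le_setTP; exists graph => // c d e; apply: sigma_code_label_inj.
apply/funext => s; have := congr1 (@^~ (pickle (s, sigma_code_label d s))) e.
by rewrite /graph pickleK eqxx => /eqP.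
Qed.

Lemma sigma_algebra_code {T : Type} (U : nat -> set T) :
  <<s range U>> `<=` range (sigma_set U).
Proof.
pose compl c := CodeNor (fun=> c).
have complE c : sigma_set U (compl c) = ~` sigma_set U c.
  by rewrite /= bigcup_const.
apply: smallest_sub; last by move=> _ [n _ <-]; exists (CodeBase n).
split=> [|_ [c _ <-]|A rA].
- exists (CodeNor (fun n => if n is 0 then CodeBase 0 else compl (CodeBase 0))) => //.
  rewrite -subset0 => x; apply; have [U0x|nU0x] := pselect (U 0 x).
    by exists 0%N.
  by exists 1%N => //=; rewrite bigcup_const.
- by exists (compl c); rewrite ?complE ?setTD.
- have /choice[c cA] n : exists c, sigma_set U c = A n.
    by have [c] := rA n; exists c.
  exists (compl (CodeNor c)) => //; rewrite complE /= setCK.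
  exact: eq_bigcupr.
Qed.

Lemma rat_cut_inj {F : realType} (v w : F) :
  (forall q : rat, v < ratr q <-> w < ratr q)%R -> v = w.
Proof.
wlog vw : v w / (v < w)%R => [wlogvw cut|cut].
  have [vw|wv|//] := ltgtP v w; first exact: wlogvw.
  by apply/esym/wlogvw => // q; rewrite cut.
have [q] := rat_in_itvoo vw; rewrite in_itv /= => /andP[/cut wq qw].
by have := lt_trans wq qw; rewrite ltxx.
Qed.

Definition sigma_code_child (c : sigma_code) (n : nat) : sigma_code :=
  if c is CodeNor f then f n else c.

(* A code [c] stands for the sequence of its children, and this sequence for the
   function [f] such that [f x < q] iff [x] belongs to the set of the child with
   index [q].  The value at a point where there is no such real is junk. *)
Definition sigma_code_fun {T : Type} {F : realType} (U : nat -> set T)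
    (c : sigma_code) (x : T) : F :=
  xget 0%R [set v | forall q : rat,
    sigma_set U (sigma_code_child c (pickle q)) x <-> (v < ratr q)%R].

Lemma restr_measurable_code_fun {T : Type} {F : realType} (U : nat -> set T)
    (Z : set T) (f : T -> F) :
  (forall q : rat, exists2 B, <<s range U>> B &
    Z `&` f @^-1` [set y | y < ratr q]%R = Z `&` B) ->
  exists c, forall x, Z x -> f x = sigma_code_fun U c x.
Proof.
move=> f_meas; have /choice[d dP] (q : rat) : exists c,
    Z `&` f @^-1` [set y | y < ratr q]%R = Z `&` sigma_set U c.
  by have [B /sigma_algebra_code[c _ <-] ->] := f_meas q; exists c.
pose c := CodeNor (fun n => if unpickle n is Some q then d q else CodeBase 0).
have cE q x : Z x ->
    sigma_set U (sigma_code_child c (pickle q)) x <-> (f x < ratr q)%R.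
  move=> Zx; rewrite /= pickleK; have := congr1 (@^~ x) (dP q).
  by rewrite /setI /= => /propeqP; tauto.
exists c => x Zx; apply/esym/xget_unique => [q|w wP]; first exact: cE.
by apply: rat_cut_inj => q; rewrite -(wP q); exact: cE.
Qed.

Definition rat_itv (F : realType) (n : nat) : set F :=
  if (unpickle n : option (rat * rat)) is Some (p, q)
  then [set x | ratr p < x < ratr q]%R else set0.

Lemma open_sigma_rat_itv {F : realType} :
  [set U : set F | open U] `<=` <<s range (@rat_itv F)>>.
Proof.
move=> U openU.
have -> : U = \bigcup_n if `[< rat_itv n `<=` U >] then rat_itv n else set0.
  apply/seteqP; split=> [x Ux|x [n _]]; last by case: asboolP => // sU /sU.
  have : nbhs x U by exact: open_nbhs_nbhs.
  rewrite -nbhs_ballE => -[e /= e0 eU].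
  have [|p] := @rat_in_itvoo F (x - e)%R x; first by rewrite ltrBlDr ltrDl.
  have [|q] := @rat_in_itvoo F x (x + e)%R; first by rewrite ltrDl.
  rewrite !in_itv /= => /andP[xq qe] /andP[pe px].
  exists (pickle (p, q)) => //; rewrite /rat_itv pickleK asboolT /= ?px //.
  move=> y /andP[py yq]; apply: eU; rewrite /ball /= ltr_norml.
  by apply/andP; split; lra.
have [sigma0 _ sigmaU] := smallest_sigma_algebra setT (range (@rat_itv F)).
apply: sigmaU => n; case: asboolP => // _.
by apply: sub_sigma_algebra; exists n.
Qed.

Lemma Borel_sigma_rat_itv : Borel `<=` <<s range (@rat_itv R)>>.
Proof. exact: smallest_sub (smallest_sigma_algebra _ _) open_sigma_rat_itv. Qed.

Definition enumerates_restr_borel (G : R -> R -> R) :=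
  forall Z f, restr_borel Z f -> exists c, forall x, Z x -> f x = G c x.

Lemma restr_borel_enumeration : exists G, enumerates_restr_borel G.
Proof.
have /pcard_surjP[code code_surj] := @card_le_sigma_code R.
exists (fun r => sigma_code_fun (@rat_itv R) (code r)) => Z f fZ.
have [q|c cP] := @restr_measurable_code_fun _ R (@rat_itv R) Z f.
  have [|B [/Borel_sigma_rat_itv sigmaB ZB]] := fZ [set y | y < ratr q]%R.
    by apply: sub_sigma_algebra; exact: open_lt.
  by exists B.
by have [c' _ c'E] := code_surj c I; exists c'; rewrite c'E.
Qed.

(** * Algebraic independence *)

Section MpolyCoef.
Local Open Scope ring_scope.
Variable n : nat.
Implicit Types (i : 'I_n.+1) (k : nat).

Definition mnm_insert i k (m : multinom n) : multinom n.+1 :=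
  Multinom [tuple if unlift i j is Some j' then m j' else k | j < n.+1].

Definition mnm_remove i (m : multinom n.+1) : multinom n :=
  Multinom [tuple m (lift i j) | j < n].

Lemma mnm_insert_eq i k m m' :
  (m' == mnm_insert i k m) = (mnm_remove i m' == m) && (m' i == k).
Proof.
apply/eqP/andP => [->|[/eqP<- /eqP<-]].
  split; last by rewrite mnmE unlift_none.
  by apply/eqP/mnmP => j; rewrite !mnmE liftK.
by apply/mnmP => j; rewrite mnmE; case: unliftP => [j' ->|->]; rewrite ?mnmE.
Qed.

Lemma mnm_removeK i (m : multinom n.+1) : mnm_insert i (m i) (mnm_remove i m) = m.
Proof. by apply/esym/eqP; rewrite mnm_insert_eq !eqxx. Qed.

(* The coefficient of ['X_i ^+ k] in [P], as a polynomial in the other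
   variables. *)
Definition mpoly_coef {K : nzRingType} i k (P : mpoly n.+1 K) : mpoly n K :=
  \sum_(m <- msupp P | m i == k) mcoeff m P *: mpolyX K (mnm_remove i m).

Lemma mcoeff_mpoly_coef {K : nzRingType} i k (P : mpoly n.+1 K) m :
  mcoeff m (mpoly_coef i k P) = mcoeff (mnm_insert i k m) P.
Proof.
rewrite raddf_sum /= [in RHS](mpolyE P) raddf_sum /= big_mkcond.
apply: eq_bigr => m' _; rewrite !mcoeffZ !mcoeffX mnm_insert_eq.
by case: (_ == k); rewrite ?andbT ?andbF ?mulr0.
Qed.

Lemma mpoly_coef_mlead_neq0 {K : nzRingType} i (P : mpoly n.+1 K) :
  P != 0 -> mpoly_coef i (mlead P i) P != 0.
Proof.
rewrite -mleadc_eq0; apply: contra_neq => coef_eq0.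
by rewrite -[X in mcoeff X](mnm_removeK i) -mcoeff_mpoly_coef coef_eq0 mcoeff0.
Qed.

Lemma mnm_lt_msize {K : nzRingType} i m (P : mpoly n.+1 K) :
  m \in msupp P -> (m i < msize P)%N.
Proof.
move=> /msize_mdeg_lt; apply: leq_ltn_trans.
by rewrite mdegE (bigD1 i) ?leq_addr.
Qed.

Lemma meval_mpoly_coef {K : comNzRingType} i (v : 'I_n.+1 -> K) (P : mpoly n.+1 K) :
  meval v P =
    \sum_(k < msize P) meval (v \o lift i) (mpoly_coef i k P) * v i ^+ k.
Proof.
under eq_bigr do rewrite raddf_sum mulr_suml.
rewrite (exchange_big_dep predT) //= mevalE big_seq [RHS]big_seq.
apply: eq_bigr => m mP; rewrite (big_pred1 (Ordinal (mnm_lt_msize i mP))).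
  rewrite mevalZ mevalX (bigD1_ord i) //= mulrCA [RHS]mulrC.
  by congr (_ * (_ * _)); apply: eq_bigr => j _; rewrite mnmE.
by move=> k; rewrite /= -val_eqE eq_sym.
Qed.

End MpolyCoef.

Section AlgebraicElements.
Local Open Scope ring_scope.

Definition semiring_span {K : comNzRingType} (A : set K) : set K :=
  [set \sum_(s <- t) \prod_(x <- s) x | t in seq_over (seq_over A)].

Definition algebraic_over {K : comNzRingType} (A : set K) : set K :=
  [set x | exists p : {poly K},
    [/\ seq_over (semiring_span A) p, p != 0 & root p x]].

Lemma semiring_span_subset {K : comNzRingType} (A B : set K) :
  A `<=` B -> semiring_span A `<=` semiring_span B.
Proof. by move=> AB; apply: image_subset; do 2!apply: seq_over_subset. Qed.

Lemma semiring_span_meval {K : comNzRingType} (F : set K) n (v : 'I_n -> K)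
    (P : mpoly n K) :
  {in msupp P, forall m, F (mcoeff m P)} ->
  semiring_span (F `|` range v) (meval v P).
Proof.
pose factors m :=
  mcoeff m P :: flatten [seq nseq (m i) (v i) | i <- enum 'I_n].
move=> FP; exists (map factors (msupp P)).
  move=> _ /mapP[m mP ->] x; rewrite inE => /orP[/eqP->|].
    by left; exact: FP.
  by move=> /flattenP[_ /mapP[i _ ->] /nseqP[-> _]]; right; exists i.
rewrite big_map mevalE; apply: eq_bigr => m _.
rewrite big_cons big_flatten big_map big_enum; congr (_ * _).
by apply: eq_bigr => i _; rewrite big_nseq iter_mulr_1.
Qed.

Lemma root_finite {K : idomainType} (p : {poly K}) :
  p != 0 -> finite_set [set x | root p x].
Proof.
move=> p0; apply: contrapT => /(infinite_set_fset (size p))[rs rsp].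
apply/negP; rewrite -ltnNge; apply: (max_poly_roots p0).
  by apply/allP => x /rsp.
exact: finmap.fset_uniq.
Qed.

Lemma card_le_algebraic_over {K : idomainType} {U : Type} (A : set K)
    (C : set U) :
  infinite_set C -> A #<= C -> algebraic_over A #<= C.
Proof.
move=> Cinf AC; have spanC : semiring_span A #<= C.
  exact: card_le_trans (card_image_le _ _)
      (card_le_seq_over Cinf (card_le_seq_over Cinf AC)).
pose D := [set p : {poly K} | seq_over (semiring_span A) p /\ p != 0].
have -> : algebraic_over A = \bigcup_(p in D) [set x | root p x].
  by apply/seteqP; split=> [x [p [Ap p0 px]]|x [p [Ap p0] px]]; exists p.
apply: infinite_card_le_bigcup => // [|p [_ p0]]; last first.
  apply: countable_card_le => //; apply: finite_set_countable.
  exact: root_finite.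
apply: card_le_trans (card_le_seq_over Cinf spanC).
apply: card_le_trans (card_image_le (@Poly K) _).
by apply: subset_card_le => p [Ap _]; exists p; rewrite ?polyseqK.
Qed.

Lemma card_lt_algebraic_over {K : idomainType} {U : Type} (A : set K)
    (C : set U) :
  ~ countable C -> A #< C -> algebraic_over A #< C.
Proof.
move=> Cunc AC; have [Afin|Ainf] := pselect (finite_set A).
  apply: contra_not Cunc => /card_le_trans; apply.
  apply: card_le_algebraic_over; first exact: infinite_nat.
  exact: finite_set_countable.
exact: card_le_lt_trans (card_le_algebraic_over Ainf (card_lexx A)) AC.
Qed.

End AlgebraicElements.

Section AlgebraicIndependence.
Local Open Scope ring_scope.

Definition alg_independent {K : comNzRingType} (F B : set K) :=
  forall n (u : 'I_n -> K) (P : mpoly n K),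
    injective u -> (forall i, B (u i)) ->
    {in msupp P, forall m, F (mcoeff m P)} -> P != 0 -> meval u P != 0.

Lemma alg_independent_subset {K : comNzRingType} (F B B' : set K) :
  B' `<=` B -> alg_independent F B -> alg_independent F B'.
Proof. by move=> B'B FB n u P uinj uB'; apply: FB => // i; exact: B'B. Qed.

Lemma alg_independent0 {K : comNzRingType} (F : set K) : alg_independent F set0.
Proof.
move=> [|n] u P _ u0 _; last by case: (u0 ord0).
by rewrite [P]nvar0_mpolyC mevalC; apply: contra_neq => ->; rewrite mpolyC0.
Qed.

Lemma total_on_bigcup_ord {T : Type} (C : set (set T)) n (u : 'I_n -> T) :
  total_on C subset -> C !=set0 -> (forall i, (\bigcup_(B in C) B) (u i)) ->
  exists2 B, C B & forall i, B (u i).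
Proof.
move=> Ctot [B0 CB0]; elim: n u => [|n IH] u uC; first by exists B0 => // -[].
have [B CB Bu] := IH (u \o lift ord0) (fun i => uC _).
have [B' CB' B'u] := uC ord0.
have [BB'|B'B] := Ctot _ _ CB CB'; [exists B' => // i|exists B => // i];
  have [j ->|->] := unliftP ord0 i; rewrite //.
- exact/BB'/Bu.
- exact: Bu.
- exact: B'B.
Qed.

Lemma alg_independent_bigcup {K : comNzRingType} (F : set K) (C : set (set K)) :
  total_on C subset -> C `<=` alg_independent F ->
  alg_independent F (\bigcup_(B in C) B).
Proof.
move=> Ctot CF; have [->|/set0P C0] := eqVneq C set0.
  by rewrite bigcup_set0; exact: alg_independent0.
move=> n u P uinj /(total_on_bigcup_ord Ctot C0)[B CB uB].
exact: CF CB _ _ _ uinj uB.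
Qed.

(* A polynomial relation involving [x] is a polynomial equation for [x], whose
   coefficients are values of polynomials at other elements of [B]; those that
   are formally nonzero do not vanish. *)
Lemma alg_independentU1 {K : comNzRingType} (F B : set K) (x : K) :
  alg_independent F B -> ~ algebraic_over (F `|` B) x ->
  alg_independent F (B `|` [set x]).
Proof.
move=> FB x_trans n u P uinj uB FP P0.
have [[i ux]|/forallNP ux] := pselect (exists i, u i = x); last first.
  by apply: FB => // i; case: (uB i) => // /ux.
case: n => [|n] in u P uinj uB FP P0 i ux *; first by case: i ux.
pose w := u \o lift i.
have wB j : B (w j).
  case: (uB (lift i j)) => // wx; case/eqP: (neq_lift i j).
  by apply: uinj; rewrite ux.
have Fcoef k :
    {in msupp (mpoly_coef i k P), forall m, F (mcoeff m (mpoly_coef i k P))}.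
  by move=> m; rewrite mcoeff_msupp mcoeff_mpoly_coef -mcoeff_msupp; exact: FP.
pose p := \poly_(k < msize P) meval w (mpoly_coef i k P).
apply: contra_not_neq x_trans => Pu0; exists p; split.
- move=> _ /(nthP 0)[k kp <-]; rewrite coef_poly (leq_trans kp (size_poly _ _)).
  apply: semiring_span_subset (semiring_span_meval w (Fcoef k)).
  by move=> y [Fy|[j _ <-]]; [left|right].
- have : p`_(mlead P i) != 0.
    rewrite coef_poly mnm_lt_msize ?mlead_supp //; apply: FB => //.
      by move=> j k /uinj /lift_inj.
    exact: mpoly_coef_mlead_neq0.
  by apply: contra_neq => ->; rewrite coef0.
- by apply/rootP; rewrite horner_poly -ux -[RHS]Pu0 (meval_mpoly_coef i).
Qed.

Lemma alg_independent_set_exists {K : idomainType} (F : set K) :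
  ~ countable [set: K] -> F #< [set: K] ->
  exists2 B, alg_independent F B & [set: K] #<= B.
Proof.
move=> Kunc Fsmall; have Kinf := uncountable_infinite Kunc.
have [C CF Ctot|B [FB Bmax]] := @Zorn_bigcup _ (alg_independent F).
  exact: alg_independent_bigcup.
exists B => //; apply: contrapT => Bsmall.
have FBsmall : F `|` B #< [set: K] by exact: card_ltU.
have /card_ltU/(_ Bsmall) := card_lt_algebraic_over Kunc FBsmall; case=> //.
apply: subset_card_le => x _; apply: contrapT => /not_orP[x_trans Bx].
apply: (Bmax (B `|` [set x])); last exact: alg_independentU1.
by split=> [y By|/(_ x)]; [left|move=> xB; apply/Bx/xB; right].
Qed.

Lemma alg_independent_family_exists {K : idomainType} (F : set K) :
  ~ countable [set: K] -> F #< [set: K] ->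
  exists y : K -> K, injective y /\ alg_independent F (range y).
Proof.
move=> Kunc /(alg_independent_set_exists Kunc)[B FB /card_le_setTP[y yinj yB]].
by exists y; split=> //; apply: alg_independent_subset FB => _ [x _ <-].
Qed.

Lemma alg_independent_meval_neq {K : comNzRingType} (F B : set K) n
    (u : 'I_n -> K) (P : mpoly n K) (c : K) :
  alg_independent F B -> injective u -> (forall i, B (u i)) ->
  {in msupp P, forall m, F (mcoeff m P)} -> F (- c) ->
  P != 0 -> mcoeff mnm0 P = 0 -> meval u P <> c.
Proof.
move=> FB uinj uB FP Fc P0 const0; have coefE m :
    mcoeff m (P - mpolyC n c) = if m == mnm0 then - c else mcoeff m P.
  rewrite mcoeffB mcoeffC; case: eqP => [->|_]; last by rewrite mulr0 subr0.
  by rewrite const0 sub0r mulr1.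
suff : meval u (P - mpolyC n c) != 0.
  by rewrite mevalB mevalC subr_eq0 => /eqP.
apply: FB => // [m|].
  rewrite mcoeff_msupp coefE; case: (m =P mnm0) => // _.
  by rewrite -mcoeff_msupp; exact: FP.
have mlead_neq0 : mlead P != mnm0.
  by apply: contraNneq P0 => mlead0; rewrite -mleadc_eq0 mlead0 const0.
apply: contraNneq P0 => Pc; rewrite -mleadc_eq0.
by have := coefE (mlead P); rewrite Pc mcoeff0 (negbTE mlead_neq0) => <-.
Qed.

Lemma card_lt_meval_eq {T V : Type} {K : comNzRingType} (C : set V)
    (F B : T -> set K) n (u : 'I_n -> T -> K) (P : mpoly n K) (g : T -> K) :
  infinite_set C -> (forall t, alg_independent (F t) (B t)) ->
  (forall i t, B t (u i t)) ->
  (forall i j, i <> j -> [set t | u i t = u j t] #< C) ->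
  (forall c, [set t | ~ F t c] #< C) -> [set t | ~ F t (- g t)] #< C ->
  P != 0 -> mcoeff mnm0 P = 0 ->
  [set t | meval (u^~ t) P = g t] #< C.
Proof.
move=> Cinf FB uB u_neq Fc Fg P0 const0.
pose g_bad := [set t | ~ F t (- g t)].
pose coef_bad := \bigcup_(m in [set` msupp P]) [set t | ~ F t (mcoeff m P)].
pose u_bad := \bigcup_(ij in [set ij : 'I_n * 'I_n | ij.1 <> ij.2])
  [set t | u ij.1 t = u ij.2 t].
apply: (@card_lt_subset _ _ _ (g_bad `|` (coef_bad `|` u_bad))).
  move=> t /= ePg; apply: contrapT.
  move=> /not_orP[/contrapT Fgt /not_orP[coef_ok u_ok]].
  apply: (alg_independent_meval_neq (FB t) _ _ _ Fgt P0 const0) ePg => //.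
    by move=> i j uij; apply: contrapT => ij; apply: u_ok; exists (i, j).
  by move=> m mP; apply: contrapT => nF; apply: coef_ok; exists m.
do 2!apply: card_ltU => //; apply: card_lt_bigcup_finite => //.
- exact: finite_seq.
- exact: finite_finset.
- by move=> ij; exact: u_neq.
Qed.

End AlgebraicIndependence.

(** * Sierpinski-Zygmund functions *)

Lemma SZ_neq0 (f : R -> R) : SZ f -> f <> (fun=> 0%R).
Proof.
move=> SZf f0; apply: (SZf setT) => [|Y _]; first exact: card_eqxx.
exists [set _ | Y 0%R]; split; last by rewrite f0.
apply: sub_sigma_algebra; have [Y0|Y0] := pselect (Y 0%R).
  by rewrite (_ : [set _ | Y 0%R] = setT); [exact: openT|apply/seteqP; split].
by rewrite (_ : [set _ | Y 0%R] = set0); [exact: open0|apply/seteqP; split].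
Qed.

Lemma card_c_ge (A : set R) : card_c A -> [set: R] #<= A.
Proof. by rewrite /card_c card_eq_sym => /card_eqPle[]. Qed.

Lemma SZ_small_coincidence (G : R -> R -> R) (f : R -> R) :
  enumerates_restr_borel G ->
  (forall c, [set t | f t = G c t] #< [set: R]) -> SZ f.
Proof.
move=> GP fG Z /card_c_ge cZ /GP[c fc].
by apply: (fG c); apply: card_le_trans cZ _; exact: subset_card_le.
Qed.

Lemma card_lt_coincidence {T U V : Type} (f g : T -> U) (A B : set U)
    (C : set V) :
  injective f -> (forall x, A (f x)) -> (forall x, B (g x)) ->
  A `&` B #< C -> [set x | f x = g x] #< C.
Proof.
move=> finj fA gB; apply: card_le_lt_trans.
rewrite -(card_le_eql (inj_card_eq (f := f) (in2W finj))).
by apply: subset_card_le => _ [x fgx <-]; split; rewrite //= fgx.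
Qed.

Theorem theorem2p6 (K : Type) (N : K -> set R) :
  (forall z, card_c (N z)) ->
  (forall z w, z <> w -> card_lt_c (N z `&` N w)) ->
  strongly_algebrable K SZ.
Proof.
move=> cN adN; have Rinf := uncountable_infinite (@uncountable_real R).
have [S [Ssmall Sfull]] := small_sets_almost_containing Rinf.
have [G GP] := restr_borel_enumeration.
have /choice[nu nuP] z : exists f : R -> R, injective f /\ forall t, N z (f t).
  by have /card_c_ge/card_le_setTP[f finj fN] := cN z; exists f.
have nu_neq z w : z <> w -> [set t | nu z t = nu w t] #< [set: R].
  by move/adN; exact: card_lt_coincidence (nuP z).1 (nuP z).2 (nuP w).2.
pose F t := S t `|` (fun c => - G c t)%R @` S t.
have Fsmall t : F t #< [set: R].
  by apply: card_ltU => //; exact: card_le_lt_trans (card_image_le _ _) (Ssmall t).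
have /choice[y yP] t := alg_independent_family_exists uncountable_real (Fsmall t).
exists (fun z t => y t (nu z t)); split=> [z w zw|n a P ainj [m Pm] P0].
  apply: contrapT => /nu_neq; apply; apply: subset_card_le => t _.
  exact/(yP t).1/(congr1 (@^~ t) zw).
suff SZP : SZ (peval P (fun i t => y t (nu (a i) t))).
  by split=> //; exact: SZ_neq0.
apply: SZ_small_coincidence GP _ => c.
apply: (card_lt_meval_eq (F := F) (B := fun t => range (y t)) Rinf) P0 => //.
- by move=> t; exact: (yP t).2.
- move=> i j ij; apply: card_lt_subset (nu_neq _ _ (contra_not (@ainj i j) ij)).
  by move=> t; exact: (yP t).1.
- by move=> b; apply: card_lt_subset (Sfull b) => t Fb Sb; apply: Fb; left.
- by apply: card_lt_subset (Sfull c) => t Fc Sc; apply: Fc; right; exists c.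
- by apply/eqP => P0; apply: Pm; rewrite P0 mcoeff0.
Qed.
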